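(* Let $(V,U)$ be an AND-OR-network with associated directed bipartite graph with arc set $\mathcal A$ and weights $\omega:\mathcal A\to\mathbb Q$. Define, for $v\in V$ and $u\in U$, $(a(u,v),\sigma(u,v))=(\omega(v,u),+)$ if $(v,u)\in\mathcal A$, $(a(u,v),\sigma(u,v))=(-\omega(u,v),-)$ if $(u,v)\in\mathcal A$, and $(a(u,v),\sigma(u,v))=(\infty,\bullet)$ otherwise. Consider the system $$\min_{v:\,\sigma(u,v)=-}(t_v+a(u,v))\ \ge\ \min_{v:\,\sigma(u,v)=+}(t_v+a(u,v))\qquad\text{for all }u\in U \qquad ( * )$$ in unknowns $(t_v)_{v\in V}\in(\mathbb R\cup\{\infty\})^V$, and the system $$t_v\ge\max_{(u,v)\in\mathcal A}(t_u+\omega(u,v))\ \ \text{for all }v\in V,\qquad t_u\ge\min_{(v,u)\in\mathcal A}(t_v+\omega(v,u))\ \ \text{for all }u\in U\qquad ( ** )$$ in unknowns $t\in(\mathbb R\cup\{\infty\})^{V\sqcup U}$. Then the set of feasible points for $( * )$ is the projection of the set of feasible starting times for $( ** )$ onto the coordinates labeled by $V$. Furthermore, for every feasible point of $( * )$ we find a feasible point of $( ** )$.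
   Context: An AND-OR-network is given by a finite set $V$ of states and a finite set $U$ of waiting conditions, which are pairs $(X,J)$ with $J\subseteq V$ and $X\subseteq V\setminus J$. Its directed bipartite graph has node set $V\sqcup U$ and, for each waiting condition $u=(X,J)$, the arcs $(x,u)$ for $x\in X$ and $(u,j)$ for $j\in J$; thus for $v\in V$, $u\in U$ at most one of $(u,v),(v,u)$ is an arc. The weight function $\omega$ on the arcs encodes processing times, or time lags if negative. A feasible point of a system, also called a vector of feasible starting times in the case of $( ** )$, is a vector satisfying all its inequalities. A minimum over an empty set is $\infty$; a maximum over an empty set imposes no condition. Arithmetic uses $\infty+c=\infty$ for real $c$. *)

(* Defs.v *)
From HB Require Import structures.
From mathcomp Require Import all_boot all_order all_algebra.
From mathcomp Require Import boolp classical_sets reals constructive_ereal.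

Set Implicit Arguments.
Unset Strict Implicit.
Unset Printing Implicit Defensive.
Import Order.TTheory GRing.Theory Num.Theory.

Local Open Scope ring_scope.
Local Open Scope ereal_scope.

Record and_or_network (V : finType) := AndOrNetwork {
  conditions : {set {set V} * {set V}};
  conditionsP : forall u, u \in conditions -> u.1 \subset ~: u.2 }.

Notation waiting N := {u | u \in conditions N}.

Definition node (V : finType) (N : and_or_network V) : Type :=
  (V + waiting N)%type.

Definition net_arc (V : finType) (N : and_or_network V) (x y : node N) : bool :=
  match x, y with
  | inl v, inr u => v \in (val u).1
  | inr u, inl v => v \in (val u).2
  | _, _ => false
  end.

Inductive tsign := Plus | Minus | Bullet.

Definition tsign_eq_dec (s s' : tsign) : decidable (s = s').
Proof. rewrite /decidable; decide equality. Defined.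

HB.instance Definition _ := hasDecEq.Build tsign (compareP tsign_eq_dec).

Section Systems.
Variables (R : realType) (V : finType) (N : and_or_network V).

(* Weights live on arcs; a total function is used, and every definition below
   evaluates it at arcs only. *)
Variable omega : node N -> node N -> rat.

Definition coef_sign (u : waiting N) (v : V) : \bar R * tsign :=
  if net_arc (inl v) (inr u) then ((ratr (omega (inl v) (inr u)))%:E, Plus)
  else if net_arc (inr u) (inl v) then ((- ratr (omega (inr u) (inl v)))%:E, Minus)
  else (+oo, Bullet).

Definition coef (u : waiting N) (v : V) : \bar R := (coef_sign u v).1.
Definition sigma (u : waiting N) (v : V) : tsign := (coef_sign u v).2.

(* The extended reals \bar R also contain -oo, which is excluded so that the
   coordinates range over the reals together with +oo. *)
Definition no_ninfty (I : Type) (t : I -> \bar R) : Prop :=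
  forall i, t i != -oo.

Definition tropical_feasible : set (V -> \bar R) :=
  [set t | no_ninfty t /\
    forall u : waiting N,
      \big[mine/+oo]_(v | sigma u v == Minus) (t v + coef u v)
      >= \big[mine/+oo]_(v | sigma u v == Plus) (t v + coef u v)].

(* With neutral element -oo, the empty maximum imposes no condition. *)
Definition scheduling_feasible : set (node N -> \bar R) :=
  [set t | [/\ no_ninfty t,
    (forall v : V, t (inl v) >=
      \big[maxe/-oo]_(u : waiting N | net_arc (inr u) (inl v))
        (t (inr u) + (ratr (omega (inr u) (inl v)))%:E))
    & (forall u : waiting N, t (inr u) >=
      \big[mine/+oo]_(v : V | net_arc (inl v) (inr u))
        (t (inl v) + (ratr (omega (inl v) (inr u)))%:E))]].

End Systems.

Arguments tropical_feasible R {V N} omega.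
Arguments scheduling_feasible R {V N} omega.

Definition proj_states (R : realType) (V : finType) (N : and_or_network V)
  (t : node N -> \bar R) : V -> \bar R := fun v => t (inl v).

(* Main.v *)
Require Import Defs.
From mathcomp Require Import all_boot all_order all_algebra.
From mathcomp Require Import boolp classical_sets reals constructive_ereal.

(** The two systems say the same thing once the coordinates [t_u] of the
    waiting conditions are eliminated.  For a fixed [u], the scheduling system
    confines [t_u] to an interval: it bounds [t_u] below by the minimum of
    [t_v + omega(v,u)] over the arcs into [u], and, the maximum at each state
    being a conjunction over the arcs [(u,v)], above by the minimum of
    [t_v - omega(u,v)] over the arcs out of [u].  The tropical inequality for
    [u] compares exactly these two bounds, so it holds if and only if a suitable
    [t_u] exists ([tropical_feasibleP] and [scheduling_feasibleP] put the systems
    in this form).  When it holds, the lower bound itself, [earliest_start], is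
    an admissible choice of [t_u], and this gives the extension. *)

Import Order.TTheory GRing.Theory Num.Theory.
Local Open Scope classical_set_scope.
Local Open Scope ereal_scope.

Section Elimination.
Set Implicit Arguments.
Unset Strict Implicit.
Unset Printing Implicit Defensive.
Context {R : realType} {V : finType} {N : and_or_network V}.
Variable omega : node N -> node N -> rat.
Implicit Types (u : waiting N) (v : V) (t : V -> \bar R) (s : node N -> \bar R).

Let w x y : \bar R := (ratr (omega x y))%:E.

(** The starting time of [u] forced by the times of its predecessors, [u] being
    an OR-node. *)
Definition earliest_start t u : \bar R :=
  \big[mine/+oo]_(v | net_arc (inl v) (inr u)) (t v + w (inl v) (inr u)).

Lemma arc_antisym u v : net_arc (inr u) (inl v) -> ~~ net_arc (inl v) (inr u).
Proof.
move=> /= vJ; apply: contraL vJ => vX.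
by have /fintype.subsetP /(_ v vX) := conditionsP (valP u); rewrite inE.
Qed.

Lemma sigma_Plus u v :
  (sigma R omega u v == Plus) = net_arc (inl v) (inr u).
Proof. by rewrite /sigma /coef_sign; case: ifP => // _; case: ifP. Qed.

(** Here the disjointness of the two parts of a waiting condition matters:
    [coef_sign] looks at the incoming arcs first. *)
Lemma sigma_Minus u v :
  (sigma R omega u v == Minus) = net_arc (inr u) (inl v).
Proof.
rewrite /sigma /coef_sign; have := @arc_antisym u v.
by case: (net_arc (inl v) _); case: (net_arc (inr u) _) => // /(_ isT).
Qed.

Lemma coef_Plus u v :
  net_arc (inl v) (inr u) -> coef R omega u v = w (inl v) (inr u).
Proof. by rewrite /coef /coef_sign => ->. Qed.

Lemma coef_Minus u v :
  net_arc (inr u) (inl v) -> coef R omega u v = - w (inr u) (inl v).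
Proof.
by move=> uv; rewrite /coef /coef_sign (negbTE (arc_antisym uv)) uv.
Qed.

Lemma tropical_rhsE t u :
  \big[mine/+oo]_(v | sigma R omega u v == Plus) (t v + coef R omega u v)
  = earliest_start t u.
Proof.
under eq_bigl do rewrite sigma_Plus.
by apply: eq_bigr => v vu; rewrite coef_Plus.
Qed.

(** Weights being finite, they can be moved across the inequality even at
    infinite times. *)
Lemma le_tropical_lhs t u (x : \bar R) :
  x <= \big[mine/+oo]_(v | sigma R omega u v == Minus) (t v + coef R omega u v)
  <-> forall v, net_arc (inr u) (inl v) -> x + w (inr u) (inl v) <= t v.
Proof.
have leE v : net_arc (inr u) (inl v) ->
    (x <= t v + coef R omega u v) = (x + w (inr u) (inl v) <= t v).
  by move=> uv; rewrite coef_Minus // leeBrDr.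
split=> [/bigmin_geP[_ xle] v uv | xle].
  by rewrite -leE // xle // sigma_Minus.
apply/bigmin_geP; split=> [|v]; first exact: leey.
by rewrite sigma_Minus => uv; rewrite leE // xle.
Qed.

Lemma tropical_feasibleP t :
  tropical_feasible R omega t <->
  no_ninfty t /\ forall u v, net_arc (inr u) (inl v) ->
    earliest_start t u + w (inr u) (inl v) <= t v.
Proof.
split=> -[tN tle]; split=> // u.
  by apply/le_tropical_lhs; rewrite -tropical_rhsE; exact: tle.
by rewrite tropical_rhsE; apply/le_tropical_lhs; exact: tle.
Qed.

Lemma scheduling_feasibleP s :
  scheduling_feasible R omega s <->
  [/\ no_ninfty s,
      forall u v, net_arc (inr u) (inl v) ->
        s (inr u) + w (inr u) (inl v) <= s (inl v)
    & forall u, earliest_start (proj_states s) u <= s (inr u)].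
Proof.
split=> -[sN sV sU]; split=> //.
  by move=> u v uv; have /bigmax_leP[_] := sV v; exact.
by move=> v; apply/bigmax_leP; split=> [|u]; [exact: leNye | exact: sV].
Qed.

Lemma earliest_start_neqNy t u : no_ninfty t -> earliest_start t u != -oo.
Proof.
move=> tN; rewrite -ltNye; apply/bigmin_gtP; split=> [|v _]; first by [].
by rewrite ltNye adde_eq_ninfty negb_or tN.
Qed.

Definition extend_earliest t (x : node N) : \bar R :=
  match x with inl v => t v | inr u => earliest_start t u end.

Lemma extend_earliest_feasible t :
  tropical_feasible R omega t ->
  scheduling_feasible R omega (extend_earliest t).
Proof.
move=> /tropical_feasibleP[tN tle]; apply/scheduling_feasibleP; split=> //.
  by case=> [v | u] /=; [exact: tN | exact: earliest_start_neqNy].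
Qed.

(** Any admissible [t_u] witnesses that its lower bound is at most its upper
    bound. *)
Lemma proj_states_feasible s :
  scheduling_feasible R omega s -> tropical_feasible R omega (proj_states s).
Proof.
move=> /scheduling_feasibleP[sN sV sU]; apply/tropical_feasibleP.
split=> [v | u v uv]; first exact: sN.
by apply: le_trans (sV u v uv); apply: leeD.
Qed.

End Elimination.

Local Close Scope ereal_scope.

Theorem theorem10 (R : realType) (V : finType) (N : and_or_network V)
    (omega : node N -> node N -> rat) :
  tropical_feasible R omega
    = (@proj_states R V N) @` (scheduling_feasible R omega)
  /\ exists extend : (V -> \bar R) -> (node N -> \bar R),
       forall t : V -> \bar R, tropical_feasible R omega t ->
         scheduling_feasible R omega (extend t)
         /\ proj_states (extend t) = t.
Proof.
split.
  apply/seteqP; split=> [t tF | _ [s sF <-]]; last exact: proj_states_feasible.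
  by exists (extend_earliest omega t) => //; exact: extend_earliest_feasible.
exists (extend_earliest omega) => t tF.
by split=> //; exact: extend_earliest_feasible.
Qed.
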